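(* Let $P$ be a zircon and let $\phi$ be an automorphism of $P$. Then the subposet of $P$ induced by the set of fixed points $\{p\in P\mid \phi(p)=p\}$ is itself a zircon.
   Context: For a poset $P$, $\lhd$ denotes its covering relation. A matching on $P$ is an involution $M:P\to P$ such that for every $p\in P$ either $M(p)\lhd p$ or $p\lhd M(p)$. A matching $M$ on $P$ is called special if for all $p,q\in P$ with $p\lhd q$, either $M(p)=q$ or $M(p)<M(q)$. A poset $P$ is a zircon if for any non-minimal element $x\in P$, the subposet induced by the principal order ideal $\{p\in P\mid p\leq x\}$ is finite and has a special matching. An automorphism of $P$ is an order isomorphism $P\to P$. The subposet induced by a subset $X\subseteq P$ is $X$ with the order restricted from $P$; matchings on a subposet refer to the covering relation of that subposet itself. *)

(* Defs.v *)
From HB Require Import structures.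
From mathcomp Require Import all_boot all_order.
From mathcomp Require Import boolp classical_sets cardinality.

Set Implicit Arguments.
Unset Strict Implicit.
Unset Printing Implicit Defensive.

Import Order.TTheory.

Local Open Scope classical_set_scope.
Local Open Scope order_scope.

(* [set_type X] carries no order in the libraries, hence this alias, which
   receives the order restricted from [P]. *)
Definition subposet (d : Order.disp_t) (P : porderType d) (X : set P) : Type :=
  set_type X.

HB.instance Definition _ (d : Order.disp_t) (P : porderType d) (X : set P) :=
  SubChoice.on (subposet X).
HB.instance Definition _ (d : Order.disp_t) (P : porderType d) (X : set P) :=
  [SubChoice_isSubPOrder of subposet X by <: with d].

Definition covers (d : Order.disp_t) (P : porderType d) (p q : P) : Prop :=
  p < q /\ ~ exists r : P, p < r /\ r < q.

Definition matching (d : Order.disp_t) (P : porderType d) (M : P -> P) : Prop :=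
  involutive M /\ forall p : P, covers (M p) p \/ covers p (M p).

Definition special_matching (d : Order.disp_t) (P : porderType d)
    (M : P -> P) : Prop :=
  matching M /\ forall p q : P, covers p q -> M p = q \/ M p < M q.

Definition minimal (d : Order.disp_t) (P : porderType d) (x : P) : Prop :=
  ~ exists y : P, y < x.

Definition principal_ideal (d : Order.disp_t) (P : porderType d) (x : P) :
  set P := [set p | p <= x].

Definition zircon (d : Order.disp_t) (P : porderType d) : Prop :=
  forall x : P, ~ minimal x ->
    finite_set (principal_ideal x) /\
    exists M : subposet (principal_ideal x) -> subposet (principal_ideal x),
      special_matching M.

Definition poset_automorphism (d : Order.disp_t) (P : porderType d)
    (phi : P -> P) : Prop :=
  bijective phi /\ {mono phi : p q / p <= q}.

(* Main.v *)
Require Import Defs.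
From mathcomp Require Import all_boot all_order.
From mathcomp Require Import boolp classical_sets cardinality.
From Stdlib Require Import Wf_nat Relation_Operators.

(** Let [x] be a fixed point of the automorphism that is not minimal among the
fixed points.  The ideal below [x] is finite, stable under the automorphism,
and has a special matching [M].  Conjugating [M] by powers of the automorphism
gives further special matchings; consider a whole family of special matchings
of the ideal, stable under this conjugation, and its orbits, the classes of
elements that can be joined by applying members of the family.

The tool is the lifting property ([special_matching_lifting]): if a special
matching [N] does not move [r] up, then [N] preserves the set of elements
below [r].  Hence an element [r] that no member of the family moves up
dominates the whole orbit of every element below it ([orbit_top_bound]); in
particular it is the maximum of its own orbit.  By finiteness every orbit has
such a maximum, and dually a minimum.

If all members of the family agree with [M] on whether they move a given fixed
point up or down, as the conjugates of [M] do, then every fixed point is either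
moved up by all of them, and is the minimum of its orbit, or moved down by all
of them, and is the maximum.  Conversely, the maximum and the minimum of the
orbit of a fixed point are fixed, because the automorphism permutes the orbits
and maps this orbit to itself ([orbit_top_fixed]).  So an orbit that meets the
set of fixed points meets it in exactly two elements, its minimum and its
maximum, and exchanging these two is a matching of the fixed points below [x].
That it is special follows from the domination property and its dual
([exchange_extrema_special]). *)

Set Implicit Arguments.
Unset Strict Implicit.

Local Open Scope classical_set_scope.

Import Order.TTheory.
Local Open Scope order_scope.

(** * Finite posets *)

(** The number of elements below [p] strictly increases with [p]. *)
Lemma finite_lt_wf d (T : porderType d) :
  finite_set [set: T] -> well_founded (fun p q : T => p < q).
Proof.
case/finite_seqP => s sE.
have mem_s z : z \in s by have : [set` s] z by rewrite -sE.
apply: (@well_founded_lt_compat _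
  (fun p => count (fun z : T => z < p) s)) => p q ltpq.
apply/ssrnat.ltP; rewrite -!size_filter.
have -> : [seq z <- s | z < p] = [seq z <- [seq z <- s | z < q] | z < p].
  rewrite -filter_predI; apply: eq_filter => z /=.
  by case: (boolP (z < p)) => //= /lt_trans -> .
rewrite [X in (X < _)%N]size_filter ltn_neqAle count_size andbT -all_count.
by apply/allPn; exists p; rewrite ?mem_filter ?ltpq ?mem_s ?ltxx.
Qed.

Lemma covers_below d (T : porderType d) (p r : T) :
  finite_set [set: T] -> p < r -> exists2 c, covers p c & c <= r.
Proof.
move=> finT; elim/(well_founded_ind (@finite_lt_wf _ _ finT)): r => r IH ltpr.
have [[c [ltpc ltcr]]|nobetween] := pselect (exists c, p < c /\ c < r).
  have [c' pc' lec'c] := IH c ltcr ltpc.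
  by exists c' => //; apply: le_trans lec'c (ltW ltcr).
by exists r.
Qed.

(** * Special matchings and the orbits they generate *)

Section Matchings.
Context {d : Order.disp_t} {T : porderType d}.
Implicit Types (p q r : T) (N : T -> T) (MM : set (T -> T)).

Lemma matching_lt N p : matching N -> N p < p \/ p < N p.
Proof. by case=> _ /(_ p) [[]|[]] *; [left|right]. Qed.

(** The lifting property of special matchings.  Going down from [r], it passes
from an element [c] to an element [q] covered by [c] because [N q] is either
[c] itself or below [N c]. *)
Lemma special_matching_lifting N q r : finite_set [set: T] ->
  special_matching N -> N r <= r -> q <= r -> N q <= r.
Proof.
move=> finT [_ specN] leNr.
have wf : well_founded (fun a b : T^d => a < b) by exact: finite_lt_wf.
elim/(well_founded_ind wf): q => q IH; rewrite le_eqVlt => /predU1P[-> //|ltqr].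
have [c qc lecr] := covers_below finT ltqr.
have [-> //|ltNqc] := specN q c qc.
by apply: le_trans (ltW ltNqc) _; apply: IH lecr; case: qc.
Qed.

(** Special matchings are self-dual, so that each statement below on maxima of
orbits, read in the dual order, becomes the statement on minima. *)
Lemma special_matching_dual N :
  special_matching N -> @special_matching _ T^d N.
Proof.
case=> -[NK covN] specN.
have covE (a b : T) : covers a b -> @covers _ T^d b a.
  by case=> ltab nob; split=> // -[r [ltbr ltra]]; apply: nob; exists r.
split; first by split=> // p; case: (covN p) => /covE; [right|left].
move=> p q [ltpq nob].
have [|<-|] := specN q p; [|by left; rewrite NK|by right].
by split=> // -[r [ltqr ltrp]]; apply: nob; exists r.
Qed.

(** For a family of involutions, the orbits of the group they generate. *)
Definition orbit MM : T -> T -> Prop :=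
  clos_refl_sym_trans T (fun a b => exists2 N, MM N & b = N a).

(** A local condition, which [orbit_top_bound] turns into being the maximum of
the orbit of [r]. *)
Definition orbit_top MM r := forall N, MM N -> N r <= r.

(** By lifting, the elements below an orbit top are stable under the family. *)
Lemma orbit_top_bound MM r a b : finite_set [set: T] ->
  MM `<=` @special_matching _ T -> orbit_top MM r ->
  orbit MM a b -> a <= r -> b <= r.
Proof.
move=> finT specMM topr orbab.
suff [] : a <= r <-> b <= r by [].
elim: orbab => {a b} [a b [N MN ->]|//|a b _ ->//|a b c _ -> _ -> //].
have lift q := special_matching_lifting (q := q) finT (specMM N MN) (topr N MN).
split; first exact: lift.
by move/lift; case: (specMM N MN) => -[-> _] _.
Qed.

(** As long as some member of the family moves an element up, follow it; by
finiteness this stops. *)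
Lemma orbit_top_exists MM p : finite_set [set: T] ->
  MM `<=` @special_matching _ T -> exists2 q, orbit MM p q & orbit_top MM q.
Proof.
move=> finT specMM.
have wf : well_founded (fun a b : T^d => a < b) by exact: finite_lt_wf.
elim/(well_founded_ind wf): p => p IH.
have [topp|] := pselect (orbit_top MM p); first by exists p => //; exact: rst_refl.
move/existsNP => [N /not_implyP[MN nle]].
have [/ltW//|ltpN] := matching_lt p (proj1 (specMM N MN)).
have [q orbq topq] := IH (N p) ltpN.
by exists q => //; apply: rst_trans orbq; apply: rst_step; exists N.
Qed.

Lemma orbit_morph MM (psi : T -> T) a b :
  (forall N, MM N -> exists2 N', MM N' & psi \o N =1 N' \o psi) ->
  orbit MM a b -> orbit MM (psi a) (psi b).
Proof.
move=> conj; elim=> {a b} [a b [N MN ->]|a|a b _|a b c _ ab _].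
- by have [N' MN' e] := conj N MN; apply: rst_step; exists N' => //; exact: e.
- exact: rst_refl.
- exact: rst_sym.
- exact: rst_trans.
Qed.

(** The maximum of a stable orbit is fixed: both [psi q] and [psi' q] lie in the
orbit of [q], hence below [q]. *)
Lemma orbit_top_fixed MM (psi psi' : T -> T) p q :
  finite_set [set: T] -> MM `<=` @special_matching _ T ->
  {homo psi : a b / a <= b} -> cancel psi' psi ->
  (forall N, MM N -> exists2 N', MM N' & psi \o N =1 N' \o psi) ->
  (forall N, MM N -> exists2 N', MM N' & psi' \o N =1 N' \o psi') ->
  psi p = p -> psi' p = p -> orbit MM p q -> orbit_top MM q -> psi q = q.
Proof.
move=> finT specMM mpsi psiK conj conj' psip psi'p orbpq topq.
have le_q a : orbit MM p a -> a <= q.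
  move=> orbpa; apply: (orbit_top_bound (MM := MM) (a := q)) => //.
  by apply: rst_trans orbpa; exact: rst_sym.
apply/le_anti/andP; split.
  by apply: le_q; rewrite -psip; exact: orbit_morph.
by rewrite -[X in X <= _]psiK; apply/mpsi/le_q; rewrite -psi'p; exact: orbit_morph.
Qed.

End Matchings.

Lemma special_matching_conj d (T : porderType d) (h h' N : T -> T) :
  {mono h : a b / a <= b} -> cancel h h' -> cancel h' h ->
  special_matching N -> special_matching (h \o N \o h').
Proof.
move=> mh hK h'K [[NK covN] specN].
have lth := leW_mono mh.
have hcov a b : covers (h a) (h b) <-> covers a b.
  rewrite /covers lth; split=> -[ltab nob]; split=> // -[r].
    by case=> ar rb; apply: nob; exists (h r); rewrite !lth.
  by rewrite -(h'K r) !lth => rb; apply: nob; exists (h' r).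
split; first split.
- by move=> p /=; rewrite hK NK h'K.
- by move=> p /=; rewrite -{2 3}(h'K p) !hcov.
move=> p q; rewrite -{1}(h'K p) -{1}(h'K q) hcov /= lth => /specN[->|].
  by left; rewrite h'K.
by right.
Qed.

(** * Matching the minimum of each class with its maximum *)

(** An abstract form of the construction: [orb] is an equivalence whose
classes consist of a minimum and a maximum, [top] and [bot] say which of the
two an element is, and [top_le] and [bot_le] are the domination property. *)
Lemma exchange_extrema_special d (F : porderType d) (orb : F -> F -> Prop)
    (top bot : F -> Prop)
    (orb_sym : forall u v, orb u v -> orb v u)
    (orb_trans : forall u v w, orb u v -> orb v w -> orb u w)
    (topVbot : forall u, top u \/ bot u)
    (topNbot : forall u, top u -> bot u -> False)
    (exists_top : forall u, exists2 v, orb u v & top v)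
    (exists_bot : forall u, exists2 v, orb u v & bot v)
    (top_le : forall r a b, top r -> orb a b -> a <= r -> b <= r)
    (bot_le : forall r a b, bot r -> orb a b -> r <= a -> r <= b) :
  exists Phi : F -> F, special_matching Phi.
Proof.
have [Phi Phi_orb Phi_tb] : exists2 Phi : F -> F, forall u, orb u (Phi u) &
    forall u, top u /\ bot (Phi u) \/ bot u /\ top (Phi u).
  suff /choice[Phi PhiP] : forall u, exists v,
      orb u v /\ (top u /\ bot v \/ bot u /\ top v).
    by exists Phi => u; case: (PhiP u).
  move=> u; have [topu|botu] := topVbot u.
    by have [v] := exists_bot u; exists v; split => //; left.
  by have [v] := exists_top u; exists v; split => //; right.
have top_max u v : orb u v -> top v -> u <= v.
  by move=> orbuv topv; apply: (top_le v v) => //; exact: orb_sym.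
have bot_min u v : orb u v -> bot v -> v <= u.
  by move=> orbuv botv; apply: (bot_le v v) => //; exact: orb_sym.
have Phi_lt u : bot u -> u < Phi u.
  have [[topu _] /(topNbot u topu)//|[botu topPu] _] := Phi_tb u.
  rewrite lt_neqAle top_max// andbT; apply/eqP => e.
  by apply: (topNbot u) => //; rewrite e.
have Phi_gt u : top u -> Phi u < u.
  have [[topu botPu] _|[botu _] /topNbot-/(_ botu)//] := Phi_tb u.
  rewrite lt_neqAle bot_min// andbT; apply/eqP => e.
  by apply: (topNbot u) => //; rewrite -e.
have PhiK : involutive Phi.
  move=> u; have orbPP : orb u (Phi (Phi u)).
    exact: orb_trans (Phi_orb u) (Phi_orb _).
  apply/le_anti/andP.
  have [[topu botPu]|[botu topPu]] := Phi_tb u.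
    have [[/topNbot/(_ botPu)//]|[_ topPP]] := Phi_tb (Phi u).
    by split; apply: top_max => //; exact: orb_sym.
  have [[_ botPP]|[/(topNbot _ topPu)//]] := Phi_tb (Phi u).
  by split; apply: bot_min => //; exact: orb_sym.
(* An element strictly between [u] and [v] would be a top, hence above [v], or
a bottom, hence below [u]. *)
have pair_covers u v : orb u v -> bot u -> top v -> u < v -> covers u v.
  move=> orbuv botu topv ltuv; split=> // -[w [ltuw ltwv]].
  have [topw|botw] := topVbot w.
    by have := top_le w u v topw orbuv (ltW ltuw); rewrite (lt_geF ltwv).
  by have := bot_le w v u botw (orb_sym u v orbuv) (ltW ltwv); rewrite (lt_geF ltuw).
exists Phi; split; first split=> // u.
  have [[topu botPu]|[botu topPu]] := Phi_tb u; [left|right].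
    by apply: pair_covers => //; [exact/orb_sym|exact: Phi_gt].
  by apply: pair_covers => //; exact: Phi_lt.
(* When [u] is a minimum and [v] a maximum, domination puts [u] below [Phi v],
which is strictly below [v], and the covering forces [u = Phi v]. *)
move=> u v [ltuv nouv].
have [[topu botPu]|[botu topPu]] := Phi_tb u;
    have [[topv botPv]|[botv topPv]] := Phi_tb v.
- right; rewrite lt_neqAle; apply/andP; split.
    by apply: contraTneq ltuv => /(can_inj PhiK) ->; rewrite ltxx.
  apply: (bot_le _ v) => //; apply: ltW; exact: lt_trans (Phi_gt u topu) ltuv.
- by right; apply: lt_trans (lt_trans ltuv (Phi_lt _ botv)); exact: Phi_gt.
- left; have := bot_le u v (Phi v) botu (Phi_orb v) (ltW ltuv).
  rewrite le_eqVlt => /predU1P[->|ltuPv]; first exact: PhiK.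
  by case: nouv; exists (Phi v); split=> //; exact: Phi_gt.
- right; rewrite lt_neqAle; apply/andP; split.
    by apply: contraTneq ltuv => /(can_inj PhiK) ->; rewrite ltxx.
  apply: (top_le _ u) => //; apply: ltW; exact: lt_trans ltuv (Phi_lt v botv).
Qed.

(** * Fixed points of an automorphism *)

(** The fixed points of [psi] are presented as the image of an order embedding
[f], to cover any type that represents them. *)
Lemma fixed_points_special_matching d (T : porderType d) d' (F : porderType d')
    (f : F -> T) (psi psi' M : T -> T) :
  finite_set [set: T] -> {mono psi : a b / a <= b} ->
  cancel psi psi' -> cancel psi' psi -> special_matching M ->
  {mono f : u v / u <= v} -> (forall p, psi p = p <-> exists u, f u = p) ->
  exists Phi : F -> F, special_matching Phi.
Proof.
move=> finT mpsi psiK psi'K specM mf imf.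
have mpsi' : {mono psi' : a b / a <= b} by move=> a b; rewrite -mpsi !psi'K.
have ltpsi := leW_mono mpsi; have ltpsi' := leW_mono mpsi'.
have fixf u : psi (f u) = f u by apply/imf; exists u.
have fix'E p : psi p = p -> psi' p = p by move=> e; rewrite -[in LHS]e psiK.
(* The agreement condition makes every fixed point a top or a bottom.  Taking
all special matchings that satisfy it, rather than only the conjugates of
[M], makes the family visibly stable under conjugation in both directions. *)
pose MM : set (T -> T) := [set N | special_matching N /\
  forall p, psi p = p -> (N p < p) = (M p < p)].
have specMM : MM `<=` @special_matching _ T by move=> N [].
have MMM : MM M by [].
have conj N : MM N -> exists2 N', MM N' & psi \o N =1 N' \o psi.
  case=> specN cohN; exists (psi \o N \o psi'); last by move=> p /=; rewrite psiK.
  split; first exact: special_matching_conj.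
  by move=> p psip /=; rewrite fix'E// -[X in _ < X]psip ltpsi cohN.
have conj' N : MM N -> exists2 N', MM N' & psi' \o N =1 N' \o psi'.
  case=> specN cohN; exists (psi' \o N \o psi); last by move=> p /=; rewrite psi'K.
  split; first exact: special_matching_conj.
  by move=> p psip /=; rewrite psip -[X in _ < X]fix'E// ltpsi' cohN.
pose top u := orbit_top MM (f u).
pose bot u := @orbit_top _ T^d MM (f u).
pose orb u v := orbit MM (f u) (f v).
have specMMd : MM `<=` @special_matching _ T^d.
  by move=> N /specMM; exact: special_matching_dual.
have top_le r a b : top r -> orb a b -> a <= r -> b <= r.
  by rewrite -!mf; exact: orbit_top_bound.
have bot_le r a b : bot r -> orb a b -> r <= a -> r <= b.
  by rewrite -!mf; exact: (@orbit_top_bound _ T^d).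
have topVbot u : top u \/ bot u.
  have [Mlt|Mgt] := matching_lt (f u) (proj1 specM); [left|right].
    by move=> N [_ cohN]; apply: ltW; rewrite cohN.
  move=> N [specN cohN].
  have [|/ltW//] := matching_lt (f u) (proj1 specN).
  by rewrite cohN// => /(lt_trans Mgt); rewrite ltxx.
have topNbot u : top u -> bot u -> False.
  move=> /(_ M MMM) le1 /(_ M MMM) le2.
  have := matching_lt (f u) (proj1 specM).
  by rewrite !lt_neqAle (@le_anti _ _ (M (f u)) (f u)) ?eqxx ?le1 ?le2 => [[]|].
have exists_top u : exists2 v, orb u v & top v.
  have [q orbq topq] := orbit_top_exists (f u) finT specMM.
  have [|v fv] := (imf q).1; last by exists v; rewrite /orb /top fv.
  by apply: orbit_top_fixed orbq topq => // [a b|]; rewrite ?mpsi ?fix'E.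
have exists_bot u : exists2 v, orb u v & bot v.
  have [q orbq botq] := @orbit_top_exists _ T^d MM (f u) finT specMMd.
  have [|v fv] := (imf q).1; last by exists v; rewrite /orb /bot fv.
  apply: (@orbit_top_fixed _ T^d MM psi psi' (f u)) => // [a b|].
    by rewrite !leEdual mpsi.
  by rewrite fix'E.
apply: (@exchange_extrema_special _ F orb top bot) => //.
- by move=> u v; exact: rst_sym.
- by move=> u v w; exact: rst_trans.
Qed.

Theorem corollary1p4 (d : Order.disp_t) (P : porderType d) (phi : P -> P)
    (zirconP : zircon P) (auto_phi : poset_automorphism phi) :
  zircon (subposet [set p : P | phi p = p]).
Proof.
case: auto_phi => -[phi' phiK phi'K] mphi x xNmin.
have [finI [M specM]] : finite_set (principal_ideal (val x)) /\
    exists M : subposet (principal_ideal (val x)) ->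
      subposet (principal_ideal (val x)), special_matching M.
  apply: zirconP => xmin; apply: xNmin => -[y ltyx].
  by apply: xmin; exists (val y); rewrite lt_val.
have phix : phi (val x) = val x by exact: set_valP x.
set I := subposet (principal_ideal (val x)) in M specM.
have ideal_phi p : principal_ideal (val x) p -> principal_ideal (val x) (phi p).
  by rewrite /principal_ideal /= -{2}phix mphi.
have ideal_phi' p :
    principal_ideal (val x) p -> principal_ideal (val x) (phi' p).
  by rewrite /principal_ideal /= -[phi' p <= _]mphi phi'K phix.
have finT : finite_set [set: I].
  apply: (@sub_finite_set _ _ ((val : I -> P) @^-1` principal_ideal (val x))).
    by move=> u _; exact: set_valP u.
  by apply: finite_preimage finI => u v _ _; exact: val_inj.
pose inI p (lepx : principal_ideal (val x) p) : I :=
  exist (fun q => q \in principal_ideal (val x)) p (mem_set lepx).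
pose psi (u : I) : I := inI _ (ideal_phi _ (set_valP u)).
pose psi' (u : I) : I := inI _ (ideal_phi' _ (set_valP u)).
pose f (u : subposet (principal_ideal x)) : I :=
  inI (val (val u)) (set_valP u).
split.
  apply: (@sub_finite_set _ _ (val @^-1` principal_ideal (val x))); first by [].
  by apply: finite_preimage finI => u v _ _; exact: val_inj.
apply: (@fixed_points_special_matching _ I _ _ f psi psi' M) => //.
- by move=> u v; exact: mphi.
- by move=> u; apply: val_inj; rewrite /= phiK.
- by move=> u; apply: val_inj; rewrite /= phi'K.
move=> p; split=> [/(congr1 val) /= fixp|[u <-]].
  pose q : subposet [set p : P | phi p = p] :=
    exist (fun q => q \in [set p : P | phi p = p]) (val p) (mem_set fixp).
  have leqx : principal_ideal x q by exact: set_valP p.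
  exists (exist (fun r => r \in principal_ideal x) q (mem_set leqx)).
  exact: val_inj.
by apply: val_inj; exact: set_valP (val u).
Qed.
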